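(* Let $\mathbb{F}$ be a field. The family of universal circuit resultants $(\mathrm{R}_{n,m})_{n,m\ge 1}$, with $\mathrm{R}_{n,m}\subset \mathbb{P}^{n-1}\times\mathbb{P}^{N(n,m)-1}$, is $\mathrm{NP}_{\mathrm{proj}}$-hard, in the sense that its re-indexing to a single-indexed sequence is $\mathrm{NP}_{\mathrm{proj}}$-hard: every sequence in $\mathrm{NP}_{\mathrm{proj}}$ reduces to it.
   Context: Conventions. $\mathbb{F}$ is any field; $\mathbb{P}^n$ is projective $n$-space over $\mathbb{F}$, and zero-sets are sets of points with coordinates in $\mathbb{F}$. A function $\mathbb{N}\to\mathbb{N}$ is polynomially bounded if it is bounded above by a polynomial. Arithmetic circuits. An arithmetic circuit over $\mathbb{F}$ is a labeled directed acyclic multigraph. Nodes of in-degree $0$ (input gates, leaves) are labeled by input variables or constants of $\mathbb{F}$; every other node is a sum gate or a product gate; every edge carries a weight in $\mathbb{F}$. A sum (resp. product) gate whose incoming edges have weights $\lambda_i$ and come from gates computing $f_i$ computes $\sum_i\lambda_i f_i$ (resp. $\prod_i \lambda_i f_i$). Gates with no outgoing edges are output gates. The size is the number of edges. A circuit is bi-homogeneous with respect to a partition of the variables into two groups (variables of bi-degree $(1,0)$ and of bi-degree $(0,1)$) if every gate computes a bi-homogeneous polynomial. For varieties in $\mathbb{P}^{n_1}\times\mathbb{P}^{n_2}$, ''homogeneous'' means bi-homogeneous in the two sets of homogeneous coordinates. Classes. A sequence $(X_n\subset\mathbb{P}^{\mathrm{n}_1(n)}\times\mathbb{P}^{\mathrm{n}_2(n)})_{n\ge1}$,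 with $\mathrm{n}_1,\mathrm{n}_2$ polynomially bounded, is in $\mathrm{P}_{\mathrm{proj}}$ if there is a sequence of homogeneous circuits, of size polynomially bounded in $n$, whose outputs are homogeneous polynomials, of number and degree polynomially bounded in $n$, with zero-set $X_n$. (Sequences in a single projective space are the case $\mathrm{n}_2=0$.) A sequence $(X_n\subset\mathbb{P}^{\mathrm{n}_1(n)})$ is in $\mathrm{NP}_{\mathrm{proj}}$ if there is a sequence $(Y_n\subset\mathbb{P}^{\mathrm{n}_1(n)}\times\mathbb{P}^{\mathrm{n}_2(n)})$ in $\mathrm{P}_{\mathrm{proj}}$ such that $X_n$ is the image of $Y_n$ under the projection to $\mathbb{P}^{\mathrm{n}_1(n)}$. Reductions. A projective-linear map $\mathbb{P}^{n_1}\times\dots\times\mathbb{P}^{n_a}\to\mathbb{P}^{m_1}\times\dots\times\mathbb{P}^{m_b}$ is a map each of whose components is either constant or a (well-defined) linear map depending on only one of the factors $\mathbb{P}^{n_i}$. A sequence $(X_n)$ reduces to $(Y_n)$ if there are a polynomially bounded $p:\mathbb{N}\to\mathbb{N}$ and projective-linear maps $\rho_n$ from the ambient space of $X_n$ to the ambient space of $Y_{p(n)}$ with $\rho_n^{-1}(Y_{p(n)})=X_n$ for all $n$. $(X_n)$ is $\mathcal{C}$-hard if every sequence in $\mathcal{C}$ reduces to it. Universal circuits. Fix a sufficiently large absolute integer constant $c\ge1$ (it accounts for the constant-factor cost of putting circuits in normal form). Given $n,m,s\ge 1$ and $(r_1,r_2)\neq(0,0)$, the circuit $\Phi^{(r_1,r_2)}$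 has input variables $x_1,\dots,x_n$ (bi-degree $(1,0)$) and $y_1,\dots,y_m$ (bi-degree $(0,1)$), and for every $(l_1,l_2)\ne(0,0)$ with $0\le l_i\le r_i$ a sum-level $(l_1,l_2)$ of sum gates and, if $(l_1,l_2)\notin\{(1,0),(0,1)\}$, a product-level $(l_1,l_2)$ of product gates. Product-level $(l_1,l_2)$ has, for each type $(j_1,j_2)$ with $0\le j_i\le l_i$ and $(j_1,j_2)\neq (0,0),(l_1,l_2)$, exactly $cs$ product gates, each of fan-in $2$, taking one input from a sum gate in sum-level $(j_1,j_2)$ and the other from a sum gate in sum-level $(l_1-j_1,l_2-j_2)$. Every sum gate has fan-out at most $1$, so each input of each product gate comes from its own sum gate, and each sum-level below $(r_1,r_2)$ contains exactly the sum gates needed for this. Every sum gate in sum-level $(l_1,l_2)$ has an incoming edge from each product gate in product-level $(l_1,l_2)$; every sum gate in sum-level $(1,0)$ has an incoming edge from each $x_i$, and every sum gate in sum-level $(0,1)$ from each $y_i$. Sum-level $(r_1,r_2)$ consists of $n$ sum gates, which are the outputs. The circuit $\Phi_{n,m,r,s}$ is the union, sharing only the input gates, of $\Phi^{(r_1,r_2)}$ over all $(r_1,r_2)\ne(0,0)$ with $0\le r_1,r_2\le r$. The circuit $\Phi'_{n,m,r,s}$ is obtained from $\Phi_{n,m,r,s}$ by introducing, for each edge $e$, a new input variable $t_e$ (control variable), splitting $e$ into two and inserting in the middle a product gate that multiplies by $t_e$; all edges of $\Phi'_{n,m,r,s}$ have weight $1$. Let $N=N(n,m,r,s)$ be the number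 of control variables. The outputs of $\Phi'_{n,m,r,s}$ are tri-homogeneous in the $x$-, $y$- and $t$-variables; let $Z_{n,m,r,s}\subset\mathbb{P}^{n-1}\times\mathbb{P}^{m-1}\times\mathbb{P}^{N-1}$ be their common zero-set. Universal circuit resultant. $\mathrm{R}_{n,m,r,s}=\pi_{1,3}(Z_{n,m,r,s})\subset\mathbb{P}^{n-1}\times\mathbb{P}^{N-1}$, where $\pi_{1,3}$ is the projection omitting the middle factor $\mathbb{P}^{m-1}$. Set $\mathrm{R}_{n,m}:=\mathrm{R}_{n,m,n,n^2+n+m}$ (that is, $r=n$ and $s=n^2+n+m$) and $N(n,m):=N(n,m,n,n^2+n+m)$. Re-indexing. The doubly indexed family is turned into a sequence by a standard enumeration of all pairs $(n,m)$ in which the position of $(n,m)$ is at most quadratic in $n+m$. *)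

(* Defs.v *)
From HB Require Import structures.
From mathcomp Require Import all_boot all_order all_algebra.
From mathcomp Require Import mpoly.
From mathcomp Require Import zify.

Set Implicit Arguments.
Unset Strict Implicit.
Unset Printing Implicit Defensive.

Import GRing.Theory.
Local Open Scope ring_scope.

Definition poly_bounded (f : nat -> nat) : Prop :=
  exists q : {poly nat}, forall n, (f n <= q.[n])%N.

(* The projective space of lines in F^k, i.e. P^(k-1); thus P^n is proj F n.+1. *)
Definition proj (F : fieldType) (k : nat) : Type :=
  {U : {vspace 'rV[F]_k} | \dim U == 1%N}.

(* mproj F [:: k_1; ..; k_a] is the product P^(k_1 - 1) x ... x P^(k_a - 1). *)
Definition mproj (F : fieldType) (d : seq nat) : Type :=
  forall i : 'I_(size d), proj F (nth 0%N d i).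

(* Component j of rho is constant, or is [v] |-> [A v] on one of the factors;
   well-definedness of the latter means that A has trivial kernel. *)
Definition projective_linear (F : fieldType) (d e : seq nat)
    (rho : mproj F d -> mproj F e) : Prop :=
  forall j : 'I_(size e),
    (exists q : proj F (nth 0%N e j), forall x, rho x j = q) \/
    (exists (i : 'I_(size d))
            (A : 'Hom('rV[F]_(nth 0%N d i), 'rV[F]_(nth 0%N e j))),
       lker A = 0%VS /\ forall x, sval (rho x j) = (A @: sval (x i))%VS).

(* The homogeneous coordinates of mproj F d: a factor i and an index below d_i. *)
Definition coord (d : seq nat) : finType :=
  {i : 'I_(size d) & 'I_(nth 0%N d i)}.

Definition mk_coord (d : seq nat) (i : nat) (lt : (i < size d)%N)
    (j : 'I_(nth 0%N d i)) : coord d :=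
  existT (fun f : 'I_(size d) => 'I_(nth 0%N d f)) (Ordinal lt) j.

(* Polynomials in a finite set V of variables; v : V is 'X_(enum_rank v). *)
Notation vpoly F V := {mpoly F[#|V : finType|]}.

Definition monom_degree (d : seq nat) (mon : 'X_{1.. #|coord d|})
    (i : 'I_(size d)) : nat :=
  (\sum_(v : coord d | tag v == i) mon (enum_rank v))%N.

Definition multihomogeneous (F : fieldType) (d : seq nat)
    (f : vpoly F (coord d)) : Prop :=
  exists e : 'I_(size d) -> nat,
    forall mon, mon \in msupp f -> forall i, monom_degree mon i = e i.

(* msize is 1 + degree; the zero polynomial gets total degree 0. *)
Definition total_degree (F : fieldType) (V : finType) (f : vpoly F V) : nat :=
  (msize f).-1.

Definition is_representative (F : fieldType) (d : seq nat) (x : mproj F d)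
    (u : forall i : 'I_(size d), 'rV[F]_(nth 0%N d i)) : Prop :=
  forall i, u i != 0 /\ u i \in sval (x i).

Definition vanishes_at (F : fieldType) (d : seq nat) (f : vpoly F (coord d))
    (x : mproj F d) : Prop :=
  forall u, is_representative x u ->
    f.@[fun k => let v : coord d := enum_val k in u (tag v) 0 (tagged v)] = 0.

Inductive gate_label (F V : Type) : Type :=
  | InputVar of V
  | InputConst of F
  | SumGate
  | ProdGate.
Arguments SumGate {F V}.
Arguments ProdGate {F V}.

Definition is_leaf_label (F V : Type) (l : gate_label F V) : bool :=
  match l with InputVar _ | InputConst _ => true | _ => false end.

(* A labeled directed multigraph with weighted edges; the remaining conditions
   on an arithmetic circuit are in is_arith_circuit. *)
Record circuit (F : fieldType) (V : finType) := Circuit {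
  gate : finType;
  edge : finType;
  src : edge -> gate;
  dst : edge -> gate;
  weight : edge -> F;
  label : gate -> gate_label F V
}.
Arguments gate {F V} c.
Arguments edge {F V} c.
Arguments src {F V} c.
Arguments dst {F V} c.
Arguments weight {F V} c.
Arguments label {F V} c.

Section CircuitTheory.
Variables (F : fieldType) (V : finType) (C : circuit F V).

Definition adjacent : rel (gate C) :=
  [rel g h | [exists e, (src C e == g) && (dst C e == h)]].

Definition acyclic : Prop := forall e, ~~ connect adjacent (dst C e) (src C e).

Definition is_arith_circuit : Prop :=
  acyclic /\
  forall g, is_leaf_label (label C g) = ~~ [exists e, dst C e == g].

Definition circuit_size : nat := #|edge C|.

Definition is_output (g : gate C) : bool := ~~ [exists e, src C e == g].

(* Recursion with fuel: in an acyclic graph a path has at most #|gate C| nodes,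
   so this much fuel suffices; see gate_polyE. *)
Fixpoint gate_poly_rec (fuel : nat) (g : gate C) : vpoly F V :=
  if fuel is k.+1 then
    match label C g with
    | InputVar v => 'X_(enum_rank v)
    | InputConst a => a%:MP
    | SumGate => \sum_(e | dst C e == g) weight C e *: gate_poly_rec k (src C e)
    | ProdGate =>
        \prod_(e | dst C e == g) (weight C e *: gate_poly_rec k (src C e))
    end
  else 0.

Definition gate_poly (g : gate C) : vpoly F V := gate_poly_rec #|gate C| g.

Let anc g := [set h | connect adjacent h g].

Lemma adjacent_edge e : adjacent (src C e) (dst C e).
Proof. by apply/existsP; exists e; rewrite !eqxx. Qed.

Lemma card_ancestors_lt e : acyclic -> (#|anc (src C e)| < #|anc (dst C e)|)%N.
Proof.
move=> acC; apply: proper_card; apply/properP; split.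
  apply/subsetP=> h; rewrite !inE => /connect_trans; apply.
  exact: connect1 (adjacent_edge e).
by exists (dst C e); rewrite inE ?connect0 // acC.
Qed.

Lemma gate_polyE g : acyclic ->
  gate_poly g =
    match label C g with
    | InputVar v => 'X_(enum_rank v)
    | InputConst a => a%:MP
    | SumGate => \sum_(e | dst C e == g) weight C e *: gate_poly (src C e)
    | ProdGate => \prod_(e | dst C e == g) (weight C e *: gate_poly (src C e))
    end.
Proof.
move=> acC.
have stable k : forall k' h, (#|anc h| <= k)%N -> (#|anc h| <= k')%N ->
    gate_poly_rec k h = gate_poly_rec k' h.
  have anc_gt0 h : (0 < #|anc h|)%N.
    by apply/card_gt0P; exists h; rewrite inE connect0.
  elim: k => [|k IH] [|k'] h hk hk' /=;
    try by have := anc_gt0 h; rewrite ltnNge ?hk ?hk'.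
  have le e : dst C e == h ->
      gate_poly_rec k (src C e) = gate_poly_rec k' (src C e).
    by move=> /eqP eh; have := card_ancestors_lt e acC; rewrite eh => lt;
       apply: IH; rewrite -ltnS; apply: leq_trans lt _.
  by case: (label C h) => //; apply: eq_bigr => e eh; rewrite le.
have le h : (#|anc h| <= #|gate C|)%N by apply: max_card.
have fuelS h : gate_poly h = gate_poly_rec #|gate C|.+1 h.
  by apply: stable; [apply: le | apply: leqW (le h)].
rewrite fuelS /=; case: (label C g) => //.
Qed.

Lemma acyclic_rank (rank : gate C -> nat) :
  (forall e, (rank (src C e) < rank (dst C e))%N) -> acyclic.
Proof.
move=> lt e; apply/negP => /connectP[p].
have mono q g : path adjacent g q -> (rank g <= rank (last g q))%N.
  elim: q g => //= h q IH g /andP[/existsP[e' /andP[/eqP <- /eqP <-]]] /IH.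
  by apply: leq_trans; apply: ltnW.
by move=> /mono le def; have := lt e; rewrite def ltnNge le.
Qed.

Lemma acyclic_has_rank : acyclic ->
  exists rank : gate C -> nat, forall e, (rank (src C e) < rank (dst C e))%N.
Proof.
by move=> acC; exists (fun g => #|anc g|) => e; apply: card_ancestors_lt.
Qed.

End CircuitTheory.

Definition homogeneous_circuit (F : fieldType) (d : seq nat)
    (C : circuit F (coord d)) : Prop :=
  forall g : gate C, multihomogeneous (gate_poly g).

Definition circuit_zeros (F : fieldType) (d : seq nat)
    (C : circuit F (coord d)) (x : mproj F d) : Prop :=
  forall g : gate C, is_output g -> vanishes_at (gate_poly g) x.

(* Sequences start at index 1; the members at index 0 are irrelevant. *)

Definition Pproj (F : fieldType) (n1 n2 : nat -> nat)
    (Y : forall k, mproj F [:: (n1 k).+1; (n2 k).+1] -> Prop) : Prop :=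
  [/\ poly_bounded n1, poly_bounded n2 &
  exists C : forall k, circuit F (coord [:: (n1 k).+1; (n2 k).+1]),
    [/\ forall k, (0 < k)%N ->
          [/\ is_arith_circuit (C k), homogeneous_circuit (C k) &
              forall z, Y k z <-> circuit_zeros (C k) z],
        poly_bounded (fun k => circuit_size (C k)),
        poly_bounded (fun k => #|[pred g : gate (C k) | is_output g]|) &
        poly_bounded (fun k =>
          \max_(g : gate (C k) | is_output g) total_degree (gate_poly g))]].

Definition NPproj (F : fieldType) (n1 : nat -> nat)
    (X : forall k, mproj F [:: (n1 k).+1] -> Prop) : Prop :=
  exists (n2 : nat -> nat)
         (Y : forall k, mproj F [:: (n1 k).+1; (n2 k).+1] -> Prop),
    Pproj Y /\
    forall k, (0 < k)%N -> forall x,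
      X k x <-> exists z, Y k z /\ z ord0 = x ord0.

Definition reduces (F : fieldType) (d e : nat -> seq nat)
    (X : forall k, mproj F (d k) -> Prop)
    (Y : forall k, mproj F (e k) -> Prop) : Prop :=
  exists p : nat -> nat, poly_bounded p /\
    forall k, (0 < k)%N -> (0 < p k)%N /\
      exists rho : mproj F (d k) -> mproj F (e (p k)),
        projective_linear rho /\ forall x, Y (p k) (rho x) <-> X k x.

Definition NPproj_hard (F : fieldType) (e : nat -> seq nat)
    (Y : forall k, mproj F (e k) -> Prop) : Prop :=
  forall (n1 : nat -> nat) (X : forall k, mproj F [:: (n1 k).+1] -> Prop),
    NPproj X -> reduces X Y.

(* Every edge e is split into two and a product gate is inserted in its middle,
   with a new input gate labeled by t e as second factor.  Gates are the old
   gates, the new input gates and the new product gates; the edges created from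
   e are src e -> middle, input -> middle and middle -> dst e, in this order. *)
Definition control (F : fieldType) (V W : finType) (C : circuit F V)
    (iota : V -> W) (t : edge C -> W) : circuit F W :=
  @Circuit F W (gate C + edge C + edge C)%type (edge C + edge C + edge C)%type
    (fun a => match a with
       | inl (inl e) => inl (inl (src C e))
       | inl (inr e) => inl (inr e)
       | inr e => inr e
       end)
    (fun a => match a with
       | inl (inl e) => inr e
       | inl (inr e) => inr e
       | inr e => inl (inl (dst C e))
       end)
    (fun _ => 1)
    (fun g => match g with
       | inl (inl h) => match label C h with
                        | InputVar v => InputVar F (iota v)
                        | InputConst a => InputConst W a
                        | SumGate => SumGate
                        | ProdGate => ProdGate
                        end
       | inl (inr e) => InputVar F (t e)
       | inr _ => ProdGate
       end).

Lemma control_arith_circuit (F : fieldType) (V W : finType) (C : circuit F V)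
    (iota : V -> W) (t : edge C -> W) :
  is_arith_circuit C -> is_arith_circuit (control iota t).
Proof.
case=> /acyclic_has_rank[rank lt] leafC; split.
  apply: (@acyclic_rank _ _ _ (fun g : gate (control iota t) => match g with
    | inl (inl h) => (rank h).*2
    | inl (inr e) => 0%N
    | inr e => (rank (src C e)).*2.+1 end)).
  by case=> [[e|e]|e] //=; rewrite ltn_Sdouble.
case=> [[h|e]|e] /=; last first.
- by apply/esym/negbTE; rewrite negbK; apply/existsP; exists (inl (inl e)).
- by apply/esym/existsPn => -[[e'|e']|e'].
rewrite (_ : is_leaf_label _ = is_leaf_label (label C h)); last first.
  by case: (label C h).
rewrite leafC; congr (~~ _); apply/existsP/existsP => -[].
  by move=> e eh; exists (inr e).
by case=> [[e|e]|e] //= eh; exists e.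
Qed.

Lemma control_output (F : fieldType) (V W : finType) (C : circuit F V)
    (iota : V -> W) (t : edge C -> W) (g : gate (control iota t)) :
  is_output g = if g is inl (inl h) then is_output h else false.
Proof.
case: g => [[h|e]|e]; rewrite /is_output.
- congr (~~ _); apply/existsP/existsP => -[].
    by case=> [[e|e]|e] //= eh; exists e.
  by move=> e eh; exists (inl (inl e)).
- by apply/negbTE; rewrite negbK; apply/existsP; exists (inl (inr e)).
- by apply/negbTE; rewrite negbK; apply/existsP; exists (inr e).
Qed.

Definition bideg (r : nat) : finType := ('I_r.+1 * 'I_r.+1)%type.
Definition bd (r : nat) (a : bideg r) : nat * nat := (val a.1, val a.2).
Definition bd_le (a b : nat * nat) : bool := (a.1 <= b.1)%N && (a.2 <= b.2)%N.
Definition bd_sub (a b : nat * nat) : nat * nat := (a.1 - b.1, a.2 - b.2)%N.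

(* A product gate: the circuit Phi^R it belongs to, its product-level l, its
   type j, and its position among the w = c * s gates of that level and type. *)
Record prod_data (r w : nat) := ProdData {
  pd_top : bideg r; pd_level : bideg r; pd_type : bideg r; pd_pos : 'I_w
}.
Definition prod_data_code r w (p : prod_data r w) :=
  (pd_top p, pd_level p, pd_type p, pd_pos p).
Definition prod_data_decode r w (q : bideg r * bideg r * bideg r * 'I_w) :=
  let: (R, l, j, k) := q in ProdData R l j k.
Lemma prod_data_codeK r w : cancel (@prod_data_code r w) (@prod_data_decode r w).
Proof. by case. Qed.
HB.instance Definition _ r w :=
  Finite.copy (prod_data r w) (can_type (@prod_data_codeK r w)).

Definition valid_prod r w (p : prod_data r w) : bool :=
  let R := bd (pd_top p) in let l := bd (pd_level p) in
  let j := bd (pd_type p) in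
  [&& R != (0, 0)%N,
      bd_le l R, l \notin [:: (0, 0); (1, 0); (0, 1)]%N,
      bd_le j l, j != (0, 0)%N & j != l].

Definition prod_gate (r w : nat) : finType := {p : prod_data r w | valid_prod p}.

Definition out_gate (n r : nat) : finType :=
  ({R : bideg r | bd R != (0, 0)%N} * 'I_n)%type.

(* Sum gates below the top are in bijection with the inputs of product gates:
   InnerG p false and InnerG p true feed the product gate p. *)
Inductive phi_gate (n m r w : nat) : Type :=
  | InXG of 'I_n
  | InYG of 'I_m
  | ProdG of prod_gate r w
  | InnerG of prod_gate r w & bool
  | OutG of out_gate n r.
Arguments InXG {n m r w}.
Arguments InYG {n m r w}.
Arguments ProdG {n m r w}.
Arguments InnerG {n m r w}.
Arguments OutG {n m r w}.

Definition phi_gate_code n m r w (g : phi_gate n m r w) :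
    'I_n + 'I_m + prod_gate r w + prod_gate r w * bool + out_gate n r :=
  match g with
  | InXG i => inl (inl (inl (inl i)))
  | InYG i => inl (inl (inl (inr i)))
  | ProdG p => inl (inl (inr p))
  | InnerG p b => inl (inr (p, b))
  | OutG o => inr o
  end.
Definition phi_gate_decode n m r w
    (g : 'I_n + 'I_m + prod_gate r w + prod_gate r w * bool + out_gate n r) :
    phi_gate n m r w :=
  match g with
  | inl (inl (inl (inl i))) => InXG i
  | inl (inl (inl (inr i))) => InYG i
  | inl (inl (inr p)) => ProdG p
  | inl (inr (p, b)) => InnerG p b
  | inr o => OutG o
  end.
Lemma phi_gate_codeK n m r w :
  cancel (@phi_gate_code n m r w) (@phi_gate_decode n m r w).
Proof. by case. Qed.
HB.instance Definition _ n m r w :=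
  Finite.copy (phi_gate n m r w) (can_type (@phi_gate_codeK n m r w)).

Definition prod_top r w (p : prod_gate r w) := bd (pd_top (val p)).
Definition prod_level r w (p : prod_gate r w) := bd (pd_level (val p)).
Definition prod_type r w (p : prod_gate r w) := bd (pd_type (val p)).

(* For a sum gate: the R of the circuit Phi^R it belongs to and its sum-level. *)
Definition sum_place n m r w (g : phi_gate n m r w) :
    option ((nat * nat) * (nat * nat)) :=
  match g with
  | InnerG p b => Some (prod_top p,
      if b then bd_sub (prod_level p) (prod_type p) else prod_type p)
  | OutG o => Some (bd (val o.1), bd (val o.1))
  | _ => None
  end.

Definition phi_adj n m r w (g h : phi_gate n m r w) : bool :=
  match g, sum_place h with
  | InXG _, Some (_, l) => l == (1, 0)%N
  | InYG _, Some (_, l) => l == (0, 1)%N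
  | ProdG p, Some (R, l) => (prod_top p == R) && (prod_level p == l)
  | InnerG p _, None => if h is ProdG q then p == q else false
  | _, _ => false
  end.

(* No two edges of Phi are parallel. *)
Definition phi_edge (n m r w : nat) : finType :=
  {a : phi_gate n m r w * phi_gate n m r w | phi_adj a.1 a.2}.

Definition phi_label (F : fieldType) n m r w (g : phi_gate n m r w) :
    gate_label F ('I_n + 'I_m) :=
  match g with
  | InXG i => InputVar F (inl i)
  | InYG i => InputVar F (inr i)
  | ProdG _ => ProdGate
  | InnerG _ _ | OutG _ => SumGate
  end.

Definition Phi (F : fieldType) (c n m r s : nat) :
    circuit F ('I_n + 'I_m)%type :=
  @Circuit F ('I_n + 'I_m)%type
    (phi_gate n m r (c * s)) (phi_edge n m r (c * s))
    (fun e => (val e).1) (fun e => (val e).2) (fun _ => 1)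
    (@phi_label F n m r (c * s)).

Lemma bd_facts (l j : nat * nat) : bd_le j l -> j != (0, 0)%N -> j != l ->
  [/\ (j.1 + j.2 < l.1 + l.2)%N,
      ((bd_sub l j).1 + (bd_sub l j).2 < l.1 + l.2)%N,
      bd_le (bd_sub l j) l & bd_sub l j != (0, 0)%N].
Proof.
case: l j => l1 l2 [j1 j2]; rewrite /bd_le /bd_sub !xpair_eqE /= => jl jn0 njl.
by split; lia.
Qed.

Section PhiTheory.
Variables (F : fieldType) (c n m r s : nat).
Hypotheses (c_gt0 : (0 < c)%N) (n_gt0 : (0 < n)%N) (m_gt0 : (0 < m)%N).
Hypotheses (r_gt0 : (0 < r)%N) (s_gt0 : (0 < s)%N).
Let w := (c * s)%N.

Lemma phi_edge_ex (g h : phi_gate n m r w) :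
  phi_adj g h -> exists e : edge (Phi F c n m r s), src _ e = g /\ dst _ e = h.
Proof. by move=> gh; exists (exist _ (g, h) gh). Qed.

Lemma prod_gate_ex (R l j : bideg r) :
  [&& bd R != (0, 0)%N, bd_le (bd l) (bd R),
      bd l \notin [:: (0, 0); (1, 0); (0, 1)]%N,
      bd_le (bd j) (bd l), bd j != (0, 0)%N & bd j != bd l] ->
  exists p : prod_gate r w,
    [/\ prod_top p = bd R, prod_level p = bd l & prod_type p = bd j].
Proof.
have w_gt0 : (0 < w)%N by rewrite muln_gt0 c_gt0.
by move=> v; exists (exist _ (ProdData R l j (Ordinal w_gt0)) v).
Qed.

Lemma sum_placeP (g : phi_gate n m r w) R l : sum_place g = Some (R, l) ->
  exists R' l' : bideg r, [/\ bd R' = R, bd l' = l & 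
    [&& R != (0, 0)%N, bd_le l R & l != (0, 0)%N]].
Proof.
case: g => // [p b|o] [<- <-]; last first.
  exists (val o.1), (val o.1); split=> //.
  by rewrite (valP o.1) /bd_le !leqnn.
have /and5P[Rn0 lR _ jl /andP[jn0 njl]] := valP p.
case: b; last first.
  exists (pd_top (val p)), (pd_type (val p)); split=> //.
  rewrite Rn0 jn0 andbT /= /bd_le in lR jl *.
  by case/andP: lR => ? ?; case/andP: jl => ? ?; apply/andP; split;
     apply: leq_trans; eassumption.
have lt1 : ((prod_level p).1 - (prod_type p).1 < r.+1)%N.
  by rewrite ltnS (leq_trans (leq_subr _ _)) // -ltnS ltn_ord.
have lt2 : ((prod_level p).2 - (prod_type p).2 < r.+1)%N.
  by rewrite ltnS (leq_trans (leq_subr _ _)) // -ltnS ltn_ord.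
exists (pd_top (val p)), (Ordinal lt1, Ordinal lt2); split=> //.
have [_ _ le n0] := bd_facts jl jn0 njl.
rewrite Rn0 n0 andbT /=; move: lR le; rewrite /bd_le.
by case/andP=> ? ? /andP[? ?]; apply/andP; split; apply: leq_trans; eassumption.
Qed.

Lemma Phi_arith_circuit : is_arith_circuit (Phi F c n m r s).
Proof.
split.
  pose wt (l : nat * nat) := (l.1 + l.2)%N.
  apply: (@acyclic_rank _ _ (Phi F c n m r s) (fun g : phi_gate n m r w =>
    match g with
    | InXG _ | InYG _ => 0%N
    | ProdG p => (wt (prod_level p)).*2
    | _ => if sum_place g is Some (_, l) then (wt l).*2.+1 else 0%N
    end)).
  move=> [[g h] /= gh]; case: g gh => [i|i|p|p b|o] /=.
  - by case: h.
  - by case: h.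
  - case: h => //= [q b|o] /andP[_ /eqP ->] //.
  - case: h => //= q /eqP <-.
    have /and5P[_ _ _ jl /andP[jn0 njl]] := valP p.
    have [lt1 lt2 _ _] := bd_facts jl jn0 njl.
    by rewrite ltn_Sdouble; case: b.
  - by [].
have leaf g : (forall h, ~~ phi_adj h g) ->
    true = ~~ [exists e, dst (Phi F c n m r s) e == g].
  move=> nadj; apply/esym/existsPn => -[[g' h] /= gh]; apply/eqP => hg.
  by move: (nadj g'); rewrite -hg gh.
have nonleaf g h : phi_adj h g ->
    false = ~~ [exists e, dst (Phi F c n m r s) e == g].
  move=> /phi_edge_ex[e [_ eg]]; apply/esym/negbTE; rewrite negbK.
  by apply/existsP; exists e; rewrite eg.
have sum_fed (g : phi_gate n m r w) R l :
    sum_place g = Some (R, l) -> exists h, phi_adj h g.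
  move=> pg; have [R' [l' [defR defl /and3P[Rn0 lR ln0]]]] := sum_placeP pg.
  have [l10|nl10] := eqVneq l (1, 0)%N.
    by exists (InXG (Ordinal n_gt0)); rewrite /phi_adj pg l10.
  have [l01|nl01] := eqVneq l (0, 1)%N.
    by exists (InYG (Ordinal m_gt0)); rewrite /phi_adj pg l01.
  have lt1 b : (nat_of_bool b < r.+1)%N by case: b.
  pose b := (0 < l.1)%N.
  have [|p [pR pl _]] :=
    @prod_gate_ex R' l' (Ordinal (lt1 b), Ordinal (lt1 (~~ b))).
    rewrite defR defl Rn0 lR !inE (negbTE ln0) (negbTE nl10) (negbTE nl01) /=.
    move: nl10 nl01 ln0; rewrite /bd_le /bd /b; case: (l) => l1 l2.
    by rewrite !xpair_eqE /=; case: l1 => [|l1] /=; lia.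
  by exists (ProdG p); rewrite /phi_adj pg pR pl defR defl !eqxx.
case=> [i|i|p|p b|o] /=.
- by apply: leaf; case.
- by apply: leaf; case.
- by apply: (@nonleaf _ (InnerG p false)); rewrite /= eqxx.
- by have [h /nonleaf] := @sum_fed (InnerG p b) _ _ erefl.
- by have [h /nonleaf] := @sum_fed (OutG o) _ _ erefl.
Qed.

Lemma Phi_output (g : gate (Phi F c n m r s)) :
  is_output g = if (g : phi_gate n m r w) is OutG _ then true else false.
Proof.
have fed (h k : phi_gate n m r w) : phi_adj h k ->
    @is_output _ _ (Phi F c n m r s) h = false.
  move=> /phi_edge_ex[e [eh _]]; apply/negbTE; rewrite negbK.
  by apply/existsP; exists e; rewrite eh.
have lt0 : (0 < r.+1)%N by [].
have lt1 : (1 < r.+1)%N by [].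
case: g => [i|i|p|p b|o].
- pose R : {R : bideg r | bd R != (0, 0)%N} :=
    exist _ (Ordinal lt1, Ordinal lt0) isT.
  by apply: (@fed _ (OutG (R, Ordinal n_gt0))).
- pose R : {R : bideg r | bd R != (0, 0)%N} :=
    exist _ (Ordinal lt0, Ordinal lt1) isT.
  by apply: (@fed _ (OutG (R, Ordinal n_gt0))).
- have /and5P[Rn0 lR lnot _ _] := valP p.
  have [lR'|nlR] := eqVneq (prod_level p) (prod_top p).
    pose R : {R : bideg r | bd R != (0, 0)%N} := exist _ (pd_top (val p)) Rn0.
    by apply: (@fed _ (OutG (R, Ordinal n_gt0))); rewrite /= lR' !eqxx.
  have [|q [qR ql qj]] :=
    @prod_gate_ex (pd_top (val p)) (pd_top (val p)) (pd_level (val p)).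
    rewrite Rn0 lR nlR /=; move: lR lnot Rn0 nlR.
    rewrite /bd_le /prod_level /prod_top /bd !inE !xpair_eqE /=; lia.
  by apply: (@fed _ (InnerG q false)); rewrite /= qR qj !eqxx.
- by apply: (@fed _ (ProdG p)); rewrite /= eqxx.
- by apply/existsPn => -[[h k] /= hk]; apply/eqP => ho; move: hk; rewrite ho.
Qed.

End PhiTheory.

Definition nb_control (c n m r s : nat) : nat := #|phi_edge n m r (c * s)|.

Definition Phi' (F : fieldType) (c n m r s : nat) :
    circuit F (coord [:: n; m; nb_control c n m r s]) :=
  let d := [:: n; m; nb_control c n m r s] in
  @control F ('I_n + 'I_m)%type (coord d) (Phi F c n m r s)
    (fun v => match v with
              | inl i => @mk_coord d 0 isT i
              | inr j => @mk_coord d 1 isT j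
              end)
    (fun e => @mk_coord d 2 isT (enum_rank e)).

Lemma Phi'_arith_circuit (F : fieldType) (c n m r s : nat) :
  (0 < c)%N -> (0 < n)%N -> (0 < m)%N -> (0 < r)%N -> (0 < s)%N ->
  is_arith_circuit (Phi' F c n m r s).
Proof.
by move=> *; apply: control_arith_circuit; apply: Phi_arith_circuit.
Qed.

Definition universal_zeros (F : fieldType) (c n m r s : nat)
    (z : mproj F [:: n; m; nb_control c n m r s]) : Prop :=
  circuit_zeros (Phi' F c n m r s) z.

(* The projection to P^(n-1) x P^(N-1) omitting the middle factor P^(m-1). *)
Definition resultant (F : fieldType) (c n m r s : nat)
    (x : mproj F [:: n; nb_control c n m r s]) : Prop :=
  exists z : mproj F [:: n; m; nb_control c n m r s],
    [/\ universal_zeros z, z (Ordinal (isT : 0 < 3)%N) = x (Ordinal (isT : 0 < 2)%N) &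
                z (Ordinal (isT : 2 < 3)%N) = x (Ordinal (isT : 1 < 2)%N)].

Definition ucr_s (n m : nat) : nat := (n ^ 2 + n + m)%N.

Definition ucr_space (c n m : nat) : seq nat :=
  [:: n; nb_control c n m n (ucr_s n m)].

Definition ucr (F : fieldType) (c n m : nat)
    (x : mproj F (ucr_space c n m)) : Prop :=
  @resultant F c n m n (ucr_s n m) x.

(* Both positions and components of pairs are positive; en 0 is irrelevant. *)
Definition quadratic_enumeration (en : nat -> nat * nat) : Prop :=
  [/\ forall k, (0 < k)%N -> (0 < (en k).1)%N && (0 < (en k).2)%N,
      forall k l, (0 < k)%N -> (0 < l)%N -> en k = en l -> k = l &
      exists K : nat, forall n m, (0 < n)%N -> (0 < m)%N ->
        exists k, [/\ (0 < k)%N, en k = (n, m) & (k <= K * (n + m) ^ 2)%N]].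

Lemma quadratic_enumeration_ex : exists en, quadratic_enumeration en.
Proof.
pose step (q : nat * nat) : nat * nat :=
  if q.1 is a.+1 then (a, q.2.+1) else (q.2.+1, 0%N).
pose cantor k := iter k step (0, 0)%N.
pose pos (q : nat * nat) := ('C((q.1 + q.2).+1, 2) + q.2)%N.
have pos_step q : pos (step q) = (pos q).+1.
  move: q => [[|a] b]; rewrite /pos /step /=.
    by rewrite addn0 add0n addn0 binS bin1; lia.
  by rewrite (addnS a) (addSn a) addnS.
have cantorK k : pos (cantor k) = k by elim: k => //= k IH; rewrite pos_step IH.
have pos_inj q q' : pos q = pos q' -> q = q'.
  case: q q' => a b [a' b']; rewrite /pos /= !bin2 /= => e.
  have tri x : ((x.+1 * x)./2.*2 = x.+1 * x)%N.
    by rewrite -[RHS]odd_double_half oddM /= andNb.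
  have := tri (a + b)%N; have := tri (a' + b')%N; move: e.
  move: (_./2) (_./2) => t t' e et' et.
  have : (a + b = a' + b')%N by nia.
  move=> eab; have : b = b' by nia.
  by move=> eb; congr pair; lia.
exists (fun k => ((cantor k.-1).1.+1, (cantor k.-1).2.+1)); split=> //.
  move=> [|k] [|l] // _ _ [e1 e2]; apply: (congr1 S).
  by rewrite -(cantorK k) -(cantorK l) /pos e1 e2.
exists 1%N => -[|a] [|b] // _ _; exists (pos (a, b)).+1; split=> //=.
  by rewrite (_ : cantor _ = (a, b)) //; apply: pos_inj; rewrite cantorK.
rewrite /pos /= mul1n bin2 /=.
have : (((a + b).+1 * (a + b))./2.*2 <= (a + b).+1 * (a + b))%N.
  by rewrite -[leqRHS]odd_double_half leq_addl.
nia.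
Qed.

(* Main.v *)
From mathcomp Require Import all_boot all_order all_algebra.
From mathcomp Require Import mpoly zify.
Require Import Defs.

(* A sequence in NPproj comes from bihomogeneous circuits C cutting out Y.
   Split every product gate of C into binary products, one for each incoming
   edge.  All gates are bihomogeneous, so up to factors of bidegree (0, 0), which
   are scalars, each gate of bidegree l is a linear combination of the variables
   and binary products of bidegree l: summands of other bidegrees cancel.
   The circuit Phi' computes exactly such systems of products of linear
   combinations, the control variables providing the coefficients, and an
   output of C of bidegree R becomes an output of Phi^R.  A control vector t is
   only defined up to a scalar lambda, but this multiplies each gate value by a
   power of lambda.  The reduction is thus x |-> (x, t), with x padded by zeros;
   a nonzero constant output of C is replaced by the outputs x_1, .., x_a of
   Phi^(1,0), which have no common zero. *)

Set Implicit Arguments.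
Unset Strict Implicit.
Unset Printing Implicit Defensive.

Import GRing.Theory.
Local Open Scope ring_scope.

(** * Bihomogeneous polynomials and graded spans *)

Section Bihomogeneous.
Variables (F : fieldType) (a b : nat).
Notation V := (coord [:: a; b]).
Implicit Types (mon : 'X_{1.. #|V|}) (f g : vpoly F V) (l : nat * nat).

Definition bidegree mon : nat * nat :=
  (monom_degree mon (Ordinal (isT : 0 < 2)%N),
   monom_degree mon (Ordinal (isT : 1 < 2)%N)).

Lemma bidegreeD mon1 mon2 :
  bidegree (mon1 + mon2)%MM = bidegree mon1 + bidegree mon2.
Proof.
by congr pair; rewrite /monom_degree -big_split; apply: eq_bigr => v _;
  rewrite mnmDE.
Qed.

Definition var_bidegree (v : V) : nat * nat :=
  if tag v == ord0 :> 'I_2 then (1, 0)%N else (0, 1)%N.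

Lemma bidegree_U (v : V) : bidegree U_(enum_rank v)%MM = var_bidegree v.
Proof.
have degU (i : 'I_2) :
    monom_degree (d := [:: a; b]) U_(enum_rank v)%MM i = (tag v == i).
  rewrite /monom_degree (bigID (pred1 v)) /= [X in (_ + X)%N]big1; last first.
    move=> u /andP[_ /negbTE uv].
    by rewrite mnm1E (inj_eq enum_rank_inj) eq_sym uv.
  rewrite addn0; have [tv|tv] := eqVneq.
    rewrite (big_pred1 v) ?mnm1E ?eqxx // => u /=.
    by case: (u =P v) => [->|_]; rewrite ?tv ?eqxx ?andbF.
  rewrite big_pred0 // => u /=.
  by case: (u =P v) => [->|_]; rewrite ?andbF ?andbT //; apply/negbTE.
rewrite /bidegree !degU /var_bidegree.
by case: (tag v) => -[|[|k]] lt.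
Qed.

Lemma bidegree_eq0 mon : bidegree mon = 0 -> mon = 0%MM.
Proof.
case=> /eqP; rewrite sum_nat_eq0 => /forallP z0 /eqP.
rewrite sum_nat_eq0 => /forallP z1.
apply/mnmP => k; rewrite mnm0E -[k]enum_valK; apply/eqP.
have := z0 (enum_val k); have := z1 (enum_val k).
by case: (tag (enum_val k)) => -[|[|j]] lt.
Qed.

Lemma bidegree_le_mdeg mon : ((bidegree mon).1 + (bidegree mon).2 <= mdeg mon)%N.
Proof.
rewrite mdegE /bidegree /= /monom_degree.
rewrite [leqRHS](reindex (@enum_rank V)); last exact/onW_bij/enum_rank_bij.
rewrite [leqRHS](bigID (fun v : V => tag v == Ordinal (isT : 0 < 2)%N)) /=.
rewrite leq_add2l [leqRHS](bigID (fun v : V => tag v == Ordinal (isT : 1 < 2)%N)) /=.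
apply: leq_trans (leq_addr _ _); apply: eq_leq; apply: eq_bigl => v.
by case: (tag v) => -[|[|k]] lt.
Qed.

(** The zero polynomial has empty support, hence is bihomogeneous of every bidegree; bidegrees are
    unique only for nonzero polynomials. *)
Definition bihomogeneous l f : bool :=
  all (fun mon => bidegree mon == l) (msupp f).

Lemma bihomogeneousP l f :
  reflect {in msupp f, forall mon, bidegree mon = l} (bihomogeneous l f).
Proof. by apply: (iffP allP) => h mon /h /eqP. Qed.

Lemma multihomogeneousP f : multihomogeneous f -> exists l, bihomogeneous l f.
Proof.
case=> e he; exists (e (Ordinal (isT : 0 < 2)%N), e (Ordinal (isT : 1 < 2)%N)).
by apply/bihomogeneousP => mon /he e_mon; rewrite /bidegree !e_mon.
Qed.

Lemma bihomogeneous1 : bihomogeneous 0 1.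
Proof.
apply/bihomogeneousP => mon; rewrite msupp1 inE => /eqP ->.
by rewrite /bidegree /monom_degree !big1 // => v _; rewrite mnm0E.
Qed.

Lemma bihomogeneousX (v : V) : bihomogeneous (var_bidegree v) 'X_(enum_rank v).
Proof.
apply/bihomogeneousP => mon; rewrite msuppX inE => /eqP ->; exact: bidegree_U.
Qed.

Lemma bihomogeneousZ l c f : bihomogeneous l f -> bihomogeneous l (c *: f).
Proof. move=> /bihomogeneousP hf.
by apply/bihomogeneousP => mon /msuppZ_le /hf. Qed.

Lemma bihomogeneousM l1 l2 f g :
  bihomogeneous l1 f -> bihomogeneous l2 g -> bihomogeneous (l1 + l2) (f * g).
Proof.
move=> /bihomogeneousP hf /bihomogeneousP hg; apply/bihomogeneousP => mon.
move=> /msuppM_le /allpairsP[[m1 m2] /= [/hf <- /hg <- ->]].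
exact: bidegreeD.
Qed.

Lemma bihomogeneous_prod (I : Type) (r : seq I) (P : pred I) (l : I -> nat * nat)
    (f : I -> vpoly F V) :
  (forall i, P i -> bihomogeneous (l i) (f i)) ->
  bihomogeneous (\sum_(i <- r | P i) l i) (\prod_(i <- r | P i) f i).
Proof.
move=> hf; apply: (big_rec2 bihomogeneous); first exact: bihomogeneous1.
by move=> i l' f' Pi; apply: bihomogeneousM; apply: hf.
Qed.

Lemma bihomogeneous_unique l1 l2 f :
  f != 0 -> bihomogeneous l1 f -> bihomogeneous l2 f -> l1 = l2.
Proof.
move=> /mlead_supp f_lead /bihomogeneousP h1 /bihomogeneousP h2.
by rewrite -(h1 _ f_lead) (h2 _ f_lead).
Qed.

(** The only monomial of bidegree 0 is 1. This is what allows factors of bidegree 0 to be absorbed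
    as scalars. *)
Lemma bihomogeneous_const f : bihomogeneous 0 f -> f = (f@_0)%:MP.
Proof.
move=> /bihomogeneousP hf; apply/mpolyP => mon; rewrite mcoeffC.
have [<-|nz] := eqVneq 0%MM mon; first by rewrite mulr1.
rewrite mulr0; apply/eqP; apply: contraNT nz; rewrite -mcoeff_msupp.
by move=> /hf /bidegree_eq0 ->.
Qed.

(* Summands of other bidegrees must cancel. *)
Lemma bihomogeneous_sum_component (I : finType) (P : pred I) (l : I -> nat * nat)
    (f : I -> vpoly F V) l0 :
  (forall i, P i -> bihomogeneous (l i) (f i)) ->
  bihomogeneous l0 (\sum_(i | P i) f i) ->
  \sum_(i | P i) f i = \sum_(i | P i && (l i == l0)) f i.
Proof.
move=> hf hsum; apply/mpolyP => mon.
have coeff0 l' g : bihomogeneous l' g -> bidegree mon != l' -> g@_mon = 0.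
  move=> /bihomogeneousP hg nl; apply/eqP; apply: contraNT nl.
  by rewrite -mcoeff_msupp => /hg ->.
have [e|ne] := eqVneq (bidegree mon) l0; last first.
  rewrite (coeff0 _ _ hsum ne) linear_sum big1 // => i /andP[Pi /eqP li].
  by apply: coeff0 (hf i Pi) _; rewrite li.
rewrite (bigID (fun i => l i == l0)) /= mcoeffD [X in _ + X]linear_sum /=.
rewrite [X in _ + X]big1 ?addr0 // => i /andP[Pi li].
by apply: coeff0 (hf i Pi) _; rewrite e eq_sym.
Qed.

Lemma bidegree_le_total_degree l f : f != 0 -> bihomogeneous l f ->
  (l.1 + l.2 <= total_degree f)%N.
Proof.
move=> /mlead_supp f_lead /bihomogeneousP hf.
rewrite -(hf _ f_lead); apply: leq_trans (bidegree_le_mdeg _) _.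
by have := msize_mdeg_lt f_lead; rewrite /total_degree; case: (msize f).
Qed.

End Bihomogeneous.

(** * Linear combinations of the members of one degree in a graded family *)

Section GradedSpan.
Variables (F : fieldType) (A : lmodType F) (I : finType).
Variables (lv : I -> nat * nat) (bs : I -> A).

Definition in_graded_span (l : nat * nat) (f : A) : Prop :=
  exists ch : I -> F, f = \sum_(i | lv i == l) ch i *: bs i.

Lemma graded_span0 l : in_graded_span l 0.
Proof. by exists (fun=> 0); rewrite big1 // => i _; rewrite scale0r. Qed.

Lemma graded_spanZ l c f : in_graded_span l f -> in_graded_span l (c *: f).
Proof.
case=> ch ->; exists (fun i => c * ch i); rewrite scaler_sumr.
by apply: eq_bigr => i _; rewrite scalerA.
Qed.

Lemma graded_spanD l f g :
  in_graded_span l f -> in_graded_span l g -> in_graded_span l (f + g).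
Proof.
move=> [ch1 ->] [ch2 ->]; exists (fun i => ch1 i + ch2 i).
by rewrite -big_split; apply: eq_bigr => i _; rewrite scalerDl.
Qed.

Lemma graded_span_sum (J : finType) (P : pred J) l (f : J -> A) :
  (forall j, P j -> in_graded_span l (f j)) ->
  in_graded_span l (\sum_(j | P j) f j).
Proof.
move=> hf; apply: (big_ind (in_graded_span l)) => //; first exact: graded_span0.
by move=> *; apply: graded_spanD.
Qed.

Lemma graded_span_basis i : in_graded_span (lv i) (bs i).
Proof.
exists (fun j => (j == i)%:R); rewrite (bigD1 i) //= eqxx scale1r.
by rewrite big1 ?addr0 // => j /andP[_ /negbTE ->]; rewrite scale0r.
Qed.

End GradedSpan.

(** * Bilinear normal form of a bihomogeneous circuit *)

(** Induction step along the enumeration of the edges. It is stated for any commutative law so that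
    it serves both products of factors and sums of their bidegrees. *)
Lemma big_prefixS (R : Type) (idx : R) (op : Monoid.com_law idx) (E : finType)
    (P : pred E) (f : E -> R) (e : E) :
  \big[op/idx]_(e' | P e' && (enum_rank e' < (enum_rank e).+1)%N) f e' =
  if P e then
    op (f e) (\big[op/idx]_(e' | P e' && (enum_rank e' < enum_rank e)%N) f e')
  else \big[op/idx]_(e' | P e' && (enum_rank e' < enum_rank e)%N) f e'.
Proof.
have ltS e' : (enum_rank e' < (enum_rank e).+1)%N =
    (e' == e) || (enum_rank e' < enum_rank e)%N.
  by rewrite ltnS leq_eqVlt val_eqE (inj_eq enum_rank_inj).
have [Pe|nPe] := boolP (P e).
  rewrite (bigD1 e) /=; last by rewrite Pe ltnS leqnn.
  congr (op _ _); apply: eq_bigl => e'; rewrite ltS -andbA; congr (_ && _).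
  by have [->|] := eqVneq; rewrite ?ltnn //= andbT.
apply: eq_bigl => e'; rewrite ltS.
by have [->|] := eqVneq; rewrite ?(negbTE nPe).
Qed.

Section NormalForm.
Variables (F : fieldType) (a b : nat).
Notation V := (coord [:: a; b]).

(** The family consists of binary products, indexed by [E], and of the variables; [d e false] and
    [d e true] are the bidegrees of the two factors of product [e]. *)
Definition level (E : finType) (d : E -> bool -> nat * nat) (i : E + V) :
    nat * nat :=
  match i with inl e => d e false + d e true | inr v => var_bidegree v end.

Variable C : circuit F V.
Hypothesis acC : acyclic C.
Variable dg : gate C -> nat * nat.
Hypothesis dgP : forall g, bihomogeneous (dg g) (gate_poly g).

Definition factor (e : edge C) : vpoly F V := weight C e *: gate_poly (src C e).

(* A product gate of large fan-in is computed one incoming edge at a time, in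
   the order of enum_rank; the edges thus index the binary products. *)
Definition prefix_prod (g : gate C) (j : nat) : vpoly F V :=
  \prod_(e | (dst C e == g) && (enum_rank e < j)%N) factor e.
Definition prefix_deg (g : gate C) (j : nat) : nat * nat :=
  \sum_(e | (dst C e == g) && (enum_rank e < j)%N) dg (src C e).

(** The universal circuit has no level (0, 0), so only products of two factors of nonzero bidegree
    can occupy a product gate; the others are scalar multiplications. *)
Definition proper_prod (e : edge C) : bool :=
  (prefix_deg (dst C e) (enum_rank e) != 0) && (dg (src C e) != 0).

(* (1, 0) is an arbitrary nonzero bidegree for the products that are not used. *)
Definition factor_deg (e : edge C) (s : bool) : nat * nat :=
  if proper_prod e then
    if s then dg (src C e) else prefix_deg (dst C e) (enum_rank e)
  else (1, 0)%N.

Definition basis (i : edge C + V) : vpoly F V :=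
  match i with
  | inl e => if proper_prod e then
               prefix_prod (dst C e) (enum_rank e) * factor e else 0
  | inr v => 'X_(enum_rank v)
  end.

Local Notation spanned := (in_graded_span (level factor_deg) basis).

Lemma factor_bihomogeneous e : bihomogeneous (dg (src C e)) (factor e).
Proof. exact/bihomogeneousZ/dgP. Qed.

Lemma prefix_bihomogeneous g j : bihomogeneous (prefix_deg g j) (prefix_prod g j).
Proof. by apply: bihomogeneous_prod => e _; apply: factor_bihomogeneous. Qed.

Lemma factor_deg_neq0 e s : factor_deg e s != 0.
Proof. by rewrite /factor_deg; case: ifP => // /andP[d1 d2]; case: s. Qed.

Lemma spanned_mul_const l l' f f' : bihomogeneous l f -> bihomogeneous l' f' ->
  l = 0 \/ l' = 0 -> (l != 0 -> spanned l f) -> (l' != 0 -> spanned l' f') ->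
  l + l' != 0 -> spanned (l + l') (f * f').
Proof.
move=> hf hf' [] l0 sf sf'; rewrite l0 ?add0r ?addr0 => ln0.
  move: hf; rewrite l0 => /bihomogeneous_const ->.
  by rewrite mul_mpolyC; apply/graded_spanZ/sf'.
move: hf'; rewrite l0 => /bihomogeneous_const ->.
by rewrite mulrC mul_mpolyC; apply/graded_spanZ/sf.
Qed.

(** Adding an edge into [g] multiplies the prefix by one factor. If one of the two bidegrees is 0,
    this is a rescaling of an element already spanned; otherwise the new prefix is itself the basis
    element of that edge. *)
Lemma spanned_prefix g j :
  (forall e, dst C e = g -> dg (src C e) != 0 ->
     spanned (dg (src C e)) (gate_poly (src C e))) ->
  (j <= #|edge C|)%N -> prefix_deg g j != 0 ->
  spanned (prefix_deg g j) (prefix_prod g j).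
Proof.
move=> span_src; elim: j => [|j IH] lt.
  by rewrite /prefix_deg big_pred0 ?eqxx // => e; rewrite andbF.
pose e := enum_val (Ordinal lt).
have rank_e : enum_rank e = j :> nat by rewrite enum_valK.
have -> : prefix_deg g j.+1 =
    if dst C e == g then dg (src C e) + prefix_deg g j else prefix_deg g j.
  by rewrite /prefix_deg -rank_e big_prefixS.
have -> : prefix_prod g j.+1 =
    if dst C e == g then factor e * prefix_prod g j else prefix_prod g j.
  by rewrite /prefix_prod -rank_e big_prefixS.
case: (dst C e =P g) => [eg|_]; last exact/IH/ltnW.
have spanf : dg (src C e) != 0 -> spanned (dg (src C e)) (factor e).
  by move=> ?; apply/graded_spanZ/span_src.
have [d0|dn0] := eqVneq (dg (src C e)) 0.
  apply: spanned_mul_const => //; [exact: factor_bihomogeneous|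
    exact: prefix_bihomogeneous|by left|exact/IH/ltnW].
have [p0|pn0] := eqVneq (prefix_deg g j) 0.
  apply: spanned_mul_const => //; [exact: factor_bihomogeneous|
    exact: prefix_bihomogeneous|by right|exact/IH/ltnW].
move=> _; have prop_e : proper_prod e by rewrite /proper_prod eg rank_e pn0.
have := graded_span_basis (level factor_deg) basis (inl e).
by rewrite /= /factor_deg prop_e eg rank_e addrC mulrC.
Qed.

Lemma spanned_gate g : dg g != 0 -> spanned (dg g) (gate_poly g).
Proof.
have [rank rank_lt] := acyclic_has_rank acC.
elim: {g}(rank g).+1 {-2}g (ltnSn (rank g)) => // k IH g lt dgn0.
(* Zero gates are set aside because [dg] is arbitrary on them; on the others it is determined by the
   polynomial. *)
have [->|gn0] := eqVneq (gate_poly g) 0; first exact: graded_span0.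
have span_src e : dst C e = g -> dg (src C e) != 0 ->
    spanned (dg (src C e)) (gate_poly (src C e)).
  by move=> eg; apply: IH; have := rank_lt e; rewrite eg => /leq_trans; apply.
have := dgP g; have := gn0; have := gate_polyE g acC.
case: (label C g) => [v|x||] def; rewrite def => {}gn0 hg.
- rewrite (bihomogeneous_unique gn0 hg (bihomogeneousX F v)).
  exact: (graded_span_basis (level factor_deg) basis (inr v)).
(* A nonzero constant has bidegree 0, against [dgn0]. *)
- case/negP: dgn0; apply/eqP; apply: bihomogeneous_unique gn0 hg _.
  rewrite -[x%:MP]mulr1 mul_mpolyC; exact/bihomogeneousZ/bihomogeneous1.
- rewrite (bihomogeneous_sum_component _ hg (l := fun e => dg (src C e))).
    apply: graded_span_sum => e /andP[/eqP eg /eqP de].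
    by apply: graded_spanZ; rewrite -de; apply: span_src; rewrite ?de.
  by move=> e _; apply: factor_bihomogeneous.
have fullE : prefix_prod g #|edge C| =
    \prod_(e | dst C e == g) (weight C e *: gate_poly (src C e)).
  by apply: eq_bigl => e; rewrite ltn_ord andbT.
have dE : dg g = prefix_deg g #|edge C|.
  apply: bihomogeneous_unique gn0 hg _; rewrite -fullE.
  exact: prefix_bihomogeneous.
by rewrite -fullE dE; apply: spanned_prefix; rewrite -?dE.
Qed.

(** This closes the system: both factors of a basis product are again linear combinations of the
    basis. *)
Lemma spanned_factor e (s : bool) : proper_prod e ->
  spanned (factor_deg e s)
    (if s then factor e else prefix_prod (dst C e) (enum_rank e)).
Proof.
move=> prop_e; rewrite /factor_deg prop_e.
have /andP[pn0 dn0] := prop_e.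
case: s; first exact/graded_spanZ/spanned_gate.
by apply: spanned_prefix => // [e' _ d'n0|]; [apply: spanned_gate|apply: ltnW].
Qed.

End NormalForm.

(** All that the simulation needs to know of the circuit: a system of products of linear
    combinations, graded by nonzero bidegrees. Improper products become 0, which is a product of two
    zero combinations. *)
Lemma bilinear_normal_form (F : fieldType) (a b : nat)
    (C : circuit F (coord [:: a; b])) :
  acyclic C -> homogeneous_circuit C ->
  exists (d : edge C -> bool -> nat * nat)
    (ic : edge C -> bool -> edge C + coord [:: a; b] -> F)
    (bs : edge C + coord [:: a; b] -> vpoly F (coord [:: a; b]))
    (dg : gate C -> nat * nat),
  [/\ forall e s, d e s != 0,
      forall v, bs (inr v) = 'X_(enum_rank v),
      forall e, bs (inl e) =
        (\sum_(i | level d i == d e false) ic e false i *: bs i) *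
        (\sum_(i | level d i == d e true) ic e true i *: bs i),
      forall g, bihomogeneous (dg g) (gate_poly g) &
      forall g, dg g != 0 -> in_graded_span (level d) bs (dg g) (gate_poly g)].
Proof.
move=> acC homC.
have [dg dgP] := fin_all_exists (fun g => multihomogeneousP (homC g)).
pose d := factor_deg dg; pose bs := basis dg.
have factorE (q : edge C * bool) :
    exists ch : edge C + coord [:: a; b] -> F,
      (if proper_prod dg q.1 then if q.2 then factor q.1
       else prefix_prod (dst C q.1) (enum_rank q.1) else 0) =
      \sum_(i | level d i == d q.1 q.2) ch i *: bs i.
  case: q => e s /=; have [prop_e|_] := ifPn; last exact: graded_span0.
  exact: spanned_factor.
have [ic icP] := fin_all_exists factorE.
exists d, (fun e s => ic (e, s)), bs, dg; split=> //.
- exact: factor_deg_neq0.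
- move=> e; rewrite -(icP (e, false)) -(icP (e, true)) /=.
  by case: (proper_prod dg e); rewrite ?mul0r.
- by move=> g; apply: spanned_gate.
Qed.

(** * Simulation by the universal circuit *)

(** Here [s] is a partial bijection from [P] onto [Q]; the elements it leaves undefined contribute
    the default 0. They will be the gates that simulate nothing. *)
Lemma big_option_bij (R : nmodType) (G I : finType) (P : pred G) (Q : pred I)
    (s : G -> option I) (f : I -> R) :
  (forall g i, P g -> s g = Some i -> Q i) ->
  (forall g1 g2 i, P g1 -> P g2 -> s g1 = Some i -> s g2 = Some i -> g1 = g2) ->
  (forall i, Q i -> exists2 g, P g & s g = Some i) ->
  \sum_(g | P g) oapp f 0 (s g) = \sum_(i | Q i) f i.
Proof.
move=> PQ inj surj; rewrite (bigID (fun g => s g)) /= addrC big1 ?add0r; last first.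
  by move=> g /andP[_]; case: (s g).
(* [i0] only makes [s] total, so that the sum can be partitioned; if [I] is empty, all terms
   vanish. *)
have [i0 _|noI] := pickP (@predT I); last first.
  rewrite !big1 // => [i|g /andP[_]]; first by have := noI i.
  by case: (s g) => // i; have := noI i.
rewrite (partition_big (fun g => odflt i0 (s g)) Q) /=; last first.
  by move=> g /andP[Pg]; case sg: (s g) => [i|] // _; apply: PQ sg.
apply: eq_bigr => i Qi; have [g Pg sg] := surj i Qi.
rewrite (big_pred1 g) ?sg // => g' /=; apply/idP/eqP => [|->]; last first.
  by rewrite Pg sg eqxx.
case/andP=> /andP[Pg']; case sg': (s g') => [i'|] //= _ /eqP ei.
by apply: inj Pg' Pg _ sg; rewrite sg' ei.
Qed.

Lemma big_phi_edge (R : Type) (idx : R) (op : Monoid.com_law idx) (n m r w : nat)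
    (f : phi_gate n m r w -> R) (h : phi_gate n m r w) :
  \big[op/idx]_(e : phi_edge n m r w | (val e).2 == h) f (val e).1 =
  \big[op/idx]_(g | phi_adj g h) f g.
Proof.
pose T := (phi_gate n m r w * phi_gate n m r w)%type.
rewrite (partition_big (fun e : phi_edge n m r w => (val e).1)
  (fun g => phi_adj g h)) /=; last first.
  by case=> [[g h'] /= gh] /eqP <-.
apply: eq_bigr => g gh; pose e : phi_edge n m r w := exist _ (g, h) gh.
rewrite (big_pred1 e) // => -[[g' h'] /= gh']; rewrite -val_eqE /= xpair_eqE.
by rewrite andbC.
Qed.

Definition ev (F : fieldType) (V : finType) (h : V -> F) (f : vpoly F V) : F :=
  f.@[fun k => h (enum_val k)].

(** At a point, the gate inserted in [e] multiplies by [h (t e)], so the control variables act as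
    the edge weights of [C], whose own weights are replaced by 1. *)
Lemma control_ev (F : fieldType) (V W : finType) (C : circuit F V)
    (iota : V -> W) (t : edge C -> W) (h : W -> F) :
  is_arith_circuit C ->
  let val_of g := ev h (gate_poly (C := control iota t) (inl (inl g))) in
  forall g, val_of g = match label C g with
    | InputVar v => h (iota v)
    | InputConst x => x
    | SumGate => \sum_(e | dst C e == g) val_of (src C e) * h (t e)
    | ProdGate => \prod_(e | dst C e == g) (val_of (src C e) * h (t e))
    end.
Proof.
move=> arC val_of g; have [acC' _] := control_arith_circuit iota t arC.
have mid e : ev h (gate_poly (C := control iota t) (inr e)) =
    val_of (src C e) * h (t e).
  rewrite gate_polyE //= /ev rmorph_prod !big_sumType /=.
  rewrite (big_pred1 e) // (big_pred1 e) // big_pred0 // mulr1 !scale1r.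
  congr (_ * _); rewrite gate_polyE //= mevalXU; congr (h _).
  exact: enum_rankK.
rewrite {1}/val_of gate_polyE //= /ev; case: (label C g) => [v|x||].
- by rewrite mevalXU enum_rankK.
- by rewrite mevalC.
- rewrite rmorph_sum !big_sumType /= big_pred0 // big_pred0 // !add0r.
  by apply: eq_bigr => e _; rewrite scale1r -mid.
- rewrite rmorph_prod !big_sumType /= big_pred0 // big_pred0 // !mul1r.
  by apply: eq_bigr => e _; rewrite scale1r -mid.
Qed.

Lemma mk_coord_inj (d : seq nat) (i : nat) (lt : (i < size d)%N) :
  injective (@mk_coord d i lt).
Proof. by move=> j1 j2 /eqP; rewrite eq_Tagged => /eqP. Qed.

Lemma mk_coordK (d : seq nat) (i : nat) (lt lt' : (i < size d)%N) j :
  existT (fun f : 'I_(size d) => 'I_(nth 0%N d f)) (Ordinal lt') j = mk_coord lt j.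
Proof. by rewrite /mk_coord (bool_irrelevance lt lt'). Qed.

(** * Control values that make the universal circuit compute a given bilinear system *)

Section Simulation.
Variables (F : fieldType) (c n a b r s : nat).
Hypotheses (c_gt0 : (0 < c)%N) (n_gt0 : (0 < n)%N) (b_gt0 : (0 < b)%N).
Hypotheses (r_gt0 : (0 < r)%N) (s_gt0 : (0 < s)%N) (le_an : (a <= n)%N).
Notation w := (c * s)%N.
Notation V := (coord [:: a; b]).
Variables (K : finType) (d : K -> bool -> nat * nat).
Hypotheses (leK : (#|K| <= w)%N) (d_neq0 : forall k i, d k i != 0).
Variables (ic : K -> bool -> K + V -> F) (oc : out_gate n r -> K + V -> F).

(** Product [k] takes position [enum_rank k] within its level and type, in every circuit Phi^R that
    has this level. Distinct products thus never compete for a gate. *)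
Definition simulated_prod (p : prod_gate r w) : option K :=
  [pick k | [&& enum_rank k == pd_pos (val p) :> nat, d k false == prod_type p &
                d k false + d k true == prod_level p]].

(** The inputs of an idle product gate get zero coefficients. *)
Definition sum_coef (g : phi_gate n b r w) (i : K + V) : F :=
  match g with
  | InnerG p e => if simulated_prod p is Some k then ic k e i else 0
  | OutG o => oc o i
  | _ => 0
  end.

Definition simulated (g : phi_gate n b r w) : option (K + V) :=
  match g with
  | InXG i => omap (fun j : 'I_a => inr (@mk_coord [:: a; b] 0 isT j)) (insub (val i))
  | InYG j => Some (inr (@mk_coord [:: a; b] 1 isT j))
  | ProdG p => omap inl (simulated_prod p)
  | _ => None
  end.

(** Edges from a sum gate into a product gate carry 1; the coefficients sit on the edges into sum
    gates. Idle product gates and the padding variables [x_i] with [i >= a] are switched off by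
    0. *)
Definition control_value (g h : phi_gate n b r w) : F :=
  if g is InnerG _ _ then 1 else oapp (sum_coef h) 0 (simulated g).

Definition control_vector : 'rV[F]_(nb_control c n b r s) :=
  \row_i control_value (val (enum_val i)).1 (val (enum_val i)).2.

(** Since [r > 0], there is a product gate of level (1, 1) and type (1, 0), and its incoming edges
    carry 1. *)
Lemma control_vector_neq0 : control_vector != 0.
Proof.
have lt1 : (1 < r.+1)%N by [].
have [//|p _] := @prod_gate_ex c r s c_gt0 s_gt0 (Ordinal lt1, Ordinal lt1)
  (Ordinal lt1, Ordinal lt1) (Ordinal lt1, ord0).
have pp : phi_adj (InnerG p false : phi_gate n b r w) (ProdG p) by rewrite /= eqxx.
pose e : phi_edge n b r w := exist _ (InnerG p false, ProdG p) pp.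
apply/eqP => /rowP/(_ (enum_rank e)); rewrite !mxE enum_rankK /=.
by apply/eqP; rewrite oner_eq0.
Qed.

Lemma simulated_prodP p k : reflect
  [/\ enum_rank k = pd_pos (val p) :> nat, d k false = prod_type p &
      d k false + d k true = prod_level p]
  (simulated_prod p == Some k).
Proof.
rewrite /simulated_prod; apply: (iffP eqP).
  by case: pickP => // k' /and3P[/eqP ? /eqP ? /eqP ?] [<-].
move=> [e1 e2 e3]; case: pickP => [k' /and3P[/eqP e1' _ _]|/(_ k)].
  by congr Some; apply/enum_rank_inj/val_inj; rewrite /= e1 e1'.
by rewrite e1 e3 e2 !eqxx.
Qed.

(** The gates feeding a sum gate of level [l], apart from those that simulate nothing, correspond
    bijectively to the basis elements of level [l]. *)
Lemma sum_simulated (g : phi_gate n b r w) R l (f : K + V -> F) :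
  sum_place g = Some (R, l) ->
  \sum_(h | phi_adj h g) oapp f 0 (simulated h) = \sum_(i | level d i == l) f i.
Proof.
move=> pg; apply: big_option_bij => [h i|h1 h2 i|i].
- rewrite /phi_adj pg; case: h => //= [j|j|p].
  + by move=> /eqP ->; case: insub => //= ? [<-].
  + by move=> /eqP -> [<-].
  + move=> /andP[_ /eqP <-]; case sp: simulated_prod => [k|] //= [<-].
    by have /eqP/simulated_prodP[_ _ e] := sp; rewrite /= e.
- rewrite /phi_adj pg; case: h1 => //= [j|j|p]; case: h2 => //= [j'|j'|p'].
  + move=> _ _; case: insubP => //= u1 _ e1 /Some_inj <-.
    case: insubP => //= u2 _ e2 e.
    have {}e := @mk_coord_inj [:: a; b] 0 isT _ _ (inr_inj (Some_inj e)).
    congr InXG; apply/val_inj.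
    exact: etrans (esym e1) (etrans (congr1 val (esym e)) e2).
  + by move=> _ _; case: insub => //= ? [<-] [].
  + by move=> _ _; case: insub => //= ? [<-]; case: simulated_prod.
  + by move=> _ _ [<-]; case: insub => //= ? [].
  + move=> _ _ /Some_inj <- e.
    by rewrite (@mk_coord_inj [:: a; b] 1 isT _ _ (inr_inj (Some_inj e))).
  + by move=> _ _ [<-]; case: simulated_prod.
  + by move=> _ _; case: simulated_prod => //= ? [<-]; case: insub.
  + by move=> _ _; case: simulated_prod => //= ? [<-].
  + move=> /andP[/eqP R1 /eqP l1] /andP[/eqP R2 /eqP l2].
    case sp: simulated_prod => [k|] //= [<-].
    case sp': simulated_prod => [k'|] //= [ek].
    have /eqP/simulated_prodP[r1 t1 _] := sp.
    have /eqP/simulated_prodP[r2 t2 _] := sp'.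
    congr ProdG; apply/val_inj.
    have bd_inj : injective (@bd r).
      by move=> [x1 x2] [y1 y2] [] /val_inj -> /val_inj ->.
    move: R1 R2 l1 l2 r1 r2 t1 t2; rewrite ek /prod_top /prod_level /prod_type.
    case: (val p) (val p') => [T1 L1 J1 P1] [T2 L2 J2 P2] /=.
    move=> <- /bd_inj -> <- /bd_inj -> -> /val_inj -> -> /bd_inj -> //.
- rewrite /phi_adj pg; have [R' [l' [defR defl /and3P[Rn0 lR ln0]]]] := sum_placeP pg.
  case: i => [k|v] /=.
    (* Surjectivity on products: by [leK] there are enough positions for [enum_rank k] to be one of
       them. *)
    move=> /eqP kl; have ltk : (enum_rank k < w)%N by apply: leq_trans leK.
    have [lt1 lt2] : ((d k false).1 <= l'.1 /\ (d k false).2 <= l'.2)%N.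
      by rewrite -[val l'.1]/(bd l').1 -[val l'.2]/(bd l').2 defl -kl /= !leq_addr.
    pose j' : bideg r := (Ordinal (leq_ltn_trans lt1 (ltn_ord _)),
                          Ordinal (leq_ltn_trans lt2 (ltn_ord _))).
    have defj : bd j' = d k false by rewrite /bd /=; case: (d k false).
    have v : valid_prod (ProdData R' l' j' (Ordinal ltk)).
      rewrite /valid_prod /= defR defl defj Rn0 lR -kl /=.
      have := d_neq0 k false; have := d_neq0 k true.
      case: (d k false) (d k true) => [x1 x2] [y1 y2].
      rewrite /bd_le !inE !xpair_eqE /= !leq_addr; lia.
    pose p : prod_gate r w := exist _ (ProdData R' l' j' (Ordinal ltk)) v.
    have sp : simulated_prod p == Some k.
      by apply/simulated_prodP; rewrite /prod_type /prod_level /= defj defl.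
    exists (ProdG p); last by rewrite /= (eqP sp).
    by rewrite /prod_top /prod_level /= defR defl !eqxx.
  case: v => -[[|[|m]] lt] j //= /eqP <-.
    exists (InXG (widen_ord le_an j)); first by rewrite eqxx.
    rewrite /= (insubT (fun i => i < a)%N (ltn_ord j)) /= -mk_coordK.
    by congr (Some (inr _)); congr existT; apply: val_inj.
  by exists (InYG j); rewrite ?eqxx //= -mk_coordK.
Qed.

Local Notation spc := [:: n; b; nb_control c n b r s].
Variables (h : coord spc -> F) (lambda : F).
Variable v : K + V -> F.
Hypothesis h_control : forall e, h (@mk_coord spc 2 isT e) =
  lambda * control_vector 0 e.
Hypothesis v_x : forall i : 'I_a, v (inr (@mk_coord [:: a; b] 0 isT i)) =
  h (@mk_coord spc 0 isT (widen_ord le_an i)).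
Hypothesis v_y : forall j, v (inr (@mk_coord [:: a; b] 1 isT j)) =
  h (@mk_coord spc 1 isT j).
Hypothesis v_prod : forall k, v (inl k) =
  (\sum_(i | level d i == d k false) ic k false i * v i) *
  (\sum_(i | level d i == d k true) ic k true i * v i).

Definition phi_ev (g : phi_gate n b r w) : F :=
  ev h (gate_poly (C := Phi' F c n b r s) (inl (inl g))).

Lemma phi_evE (g : phi_gate n b r w) :
  phi_ev g = match g with
    | InXG i => h (@mk_coord spc 0 isT i)
    | InYG j => h (@mk_coord spc 1 isT j)
    | ProdG _ =>
        \prod_(g' | phi_adj g' g) (phi_ev g' * (lambda * control_value g' g))
    | _ => \sum_(g' | phi_adj g' g) phi_ev g' * (lambda * control_value g' g)
    end.
Proof.
have arC := Phi_arith_circuit F c_gt0 n_gt0 b_gt0 r_gt0 s_gt0.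
have ctrlE (e : phi_edge n b r w) :
    h (@mk_coord spc 2 isT (enum_rank e)) =
    lambda * control_value (val e).1 (val e).2.
  by rewrite h_control mxE enum_rankK.
have E := @control_ev F _ _ (Phi F c n b r s) (fun v : 'I_n + 'I_b => match v with
    | inl i => @mk_coord spc 0 isT i
    | inr j => @mk_coord spc 1 isT j end)
  (fun e : phi_edge n b r w => @mk_coord spc 2 isT (enum_rank e)) h arC g.
rewrite /phi_ev [LHS]E.
case: g {E} => [i|j|p|p e|o] //=.
- rewrite -(big_phi_edge _ (fun g' => phi_ev g' * (lambda * control_value g' (ProdG p)))).
  by apply: eq_bigr => e /eqP eg; rewrite ctrlE eg.
- rewrite -(big_phi_edge _ (fun g' => phi_ev g' * (lambda * control_value g' (InnerG p e)))).
  by apply: eq_bigr => e' /eqP eg; rewrite ctrlE eg.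
- rewrite -(big_phi_edge _ (fun g' => phi_ev g' * (lambda * control_value g' (OutG o)))).
  by apply: eq_bigr => e' /eqP eg; rewrite ctrlE eg.
Qed.

Lemma phi_ev_prod p : phi_ev (ProdG p) =
  phi_ev (InnerG p false) * phi_ev (InnerG p true) * lambda ^+ 2.
Proof.
rewrite phi_evE (bigD1 (InnerG p false)) /=; last by rewrite eqxx.
rewrite (bigD1 (InnerG p true)) /=; last by rewrite eqxx; apply/eqP; case.
rewrite big1 ?mulr1; first by rewrite mulrACA expr2.
by case=> //= q [] /andP[/andP[/eqP ->]]; rewrite eqxx.
Qed.

(* The exponent e(l) of lambda is 1 on the levels (1, 0) and (0, 1), and satisfies
   e(l) = e(j) + e(l - j) + 3 since a product of type j adds three edges. *)
Lemma phi_ev_sum (g : phi_gate n b r w) R l : sum_place g = Some (R, l) ->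
  phi_ev g = lambda ^+ (4 * (l.1 + l.2) - 3) *
             \sum_(i | level d i == l) sum_coef g i * v i.
Proof.
have [k] := ubnP (l.1 + l.2)%N; elim: k => // k IH in g R l *.
rewrite ltnS => lk pg.
have -> : phi_ev g =
    \sum_(g' | phi_adj g' g) phi_ev g' * (lambda * control_value g' g).
  by case: (g) pg => // *; rewrite phi_evE.
have [R' [l' [defR defl /and3P[Rn0 lR ln0]]]] := sum_placeP pg.
have l_gt0 : (0 < l.1 + l.2)%N.
  by move: ln0; case: (l) => l1 l2; rewrite xpair_eqE /=; lia.
rewrite -(sum_simulated _ pg) mulr_sumr; apply: eq_bigr => g' adj.
rewrite /control_value mulrA [phi_ev g' * _]mulrC.
(* One factor [lambda] belongs to the edge into [g]. For a product gate, the remaining exponent is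
   the sum of those of its two inputs, plus 2 for the edges between; positive levels keep the
   subtractions from truncating. *)
have -> : (4 * (l.1 + l.2) - 3)%N = (4 * (l.1 + l.2) - 4).+1 by lia.
rewrite exprS -!mulrA; congr (_ * _).
move: adj; rewrite /phi_adj pg; case: g' => // [i|j|p].
- move=> /eqP ->; rewrite phi_evE /= mul1r; case: insubP => /= [u _ ui|]; last first.
    by rewrite mulr0.
  rewrite mulrC v_x; congr (_ * h (mk_coord _ _)); exact: val_inj.
- by move=> /eqP ->; rewrite phi_evE /= mul1r mulrC v_y.
- move=> /andP[/eqP pR /eqP pl] /=.
  case sp: simulated_prod => [q|] /=; last by rewrite !mulr0.
  have /eqP/simulated_prodP[_ d1 d12] := sp.
  have /and5P[_ _ _ jl /andP[jn0 njl]] := valP p.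
  have [lt1 lt2 _ _] := bd_facts jl jn0 njl.
  have d2 : d q true = bd_sub (prod_level p) (prod_type p).
    by rewrite -d12 -d1 /bd_sub /= !addKn; case: (d q true).
  have dgt0 e : (0 < (d q e).1 + (d q e).2)%N.
    by have := d_neq0 q e; case: (d q e) => x y; rewrite xpair_eqE /=; lia.
  have IHe e : phi_ev (InnerG p e) = lambda ^+ (4 * ((d q e).1 + (d q e).2) - 3) *
      \sum_(i | level d i == d q e) ic q e i * v i.
    rewrite (IH (InnerG p e) (prod_top p) (d q e)) /= ?sp //.
      apply: leq_trans lk; rewrite -pl.
      by case: e; [rewrite d2; apply: lt2|rewrite d1; apply: lt1].
    by case: e; rewrite ?d2 ?d1.
  rewrite phi_ev_prod !IHe v_prod -pl -d12.
  rewrite [X in X * _ * _]mulrACA -exprD.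
  rewrite [X in X * _]mulrAC -exprD [RHS]mulrCA mulrC.
  congr (_ * (lambda ^+ _ * _)); have := dgt0 false; have := dgt0 true.
  rewrite /=; lia.
Qed.

End Simulation.

(** * Evaluation of spans and choice of the output coefficients *)

Lemma evX (F : fieldType) (V : finType) (h : V -> F) v :
  ev h 'X_(enum_rank v) = h v.
Proof. by rewrite /ev mevalXU enum_rankK. Qed.

Lemma ev_lincomb (F : fieldType) (V : finType) (h : V -> F) (I : finType)
    (P : pred I) (ch : I -> F) (f : I -> vpoly F V) :
  ev h (\sum_(i | P i) ch i *: f i) = \sum_(i | P i) ch i * ev h (f i).
Proof. by rewrite /ev rmorph_sum; apply: eq_bigr => i _; apply: mevalZ. Qed.

(** Output number [i] of [C], of bidegree R, is assigned to output [i] of Phi^R; unassigned outputs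
    are made zero. The degree and output bounds ensure that this place exists. *)
Lemma output_coefficients (F : fieldType) (a b n : nat)
    (C : circuit F (coord [:: a; b])) (d : edge C -> bool -> nat * nat)
    (bs : edge C + coord [:: a; b] -> vpoly F (coord [:: a; b]))
    (dg : gate C -> nat * nat) :
  (forall v, bs (inr v) = 'X_(enum_rank v)) ->
  (forall g, bihomogeneous (dg g) (gate_poly g)) ->
  (forall g, dg g != 0 -> in_graded_span (level d) bs (dg g) (gate_poly g)) ->
  (a <= n)%N -> (#|[pred g : gate C | is_output g]| <= n)%N ->
  (\max_(g : gate C | is_output g) total_degree (gate_poly g) <= n)%N ->
  exists oc : out_gate n n -> edge C + coord [:: a; b] -> F,
    forall h : coord [:: a; b] -> F,
    (exists i : 'I_a, h (@mk_coord [:: a; b] 0 isT i) != 0) ->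
    (forall o, \sum_(i | level d i == bd (val o.1)) oc o i * ev h (bs i) = 0) <->
    (forall g : gate C, is_output g -> ev h (gate_poly g) = 0).
Proof.
move=> bsX dgP span le_an outs_le deg_le.
have [/existsP[g0 /and3P[out0 gn0 /eqP dg0]]|/existsPn non_const] :=
  boolP [exists g : gate C, [&& is_output g, gate_poly g != 0 & dg g == 0]].
  (* A nonzero constant output is replaced by x_1, .., x_a. *)
  exists (fun (o : out_gate n n) (i : edge C + coord [:: a; b]) =>
    [exists j : 'I_a, (val j == val o.2) && (i == inr (@mk_coord [:: a; b] 0 isT j))]%:R) => h [j hj].
  (* Both sides are false: the constant output does not vanish, and output [j] of Phi^(1,0) is the
     nonzero coordinate [h] of [x_j]. *)
  split=> zero; last first.
    have := zero g0 out0; have := dgP g0; rewrite dg0 => /bihomogeneous_const e.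
    rewrite e in gn0 *; rewrite /ev mevalC => c0.
    by rewrite c0 mpolyC0 eqxx in gn0.
  have lt1 : (1 < n.+1)%N by have := ltn_ord j; lia.
  pose R : {R : bideg n | bd R != (0, 0)%N} :=
    exist _ (Ordinal lt1, ord0) isT.
  have := zero (R, widen_ord le_an j).
  rewrite (bigD1 (inr (@mk_coord [:: a; b] 0 isT j))) //= big1 ?addr0; last first.
    move=> i /andP[_ /negbTE ij]; case: existsP => [[k /andP[/eqP /= kj]]|_].
      by move=> /eqP; rewrite (val_inj kj) => e; rewrite e eqxx in ij.
    by rewrite mul0r.
  have -> : [exists k : 'I_a, (val k == val j) &&
    (inr (@mk_coord [:: a; b] 0 isT j) ==
     inr (@mk_coord [:: a; b] 0 isT k) :> edge C + coord [:: a; b])].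
    by apply/existsP; exists j; rewrite !eqxx.
  by rewrite mul1r bsX evX => hj0; rewrite hj0 eqxx in hj.
have gateE g : exists ch : edge C + coord [:: a; b] -> F,
    dg g != 0 -> gate_poly g = \sum_(i | level d i == dg g) ch i *: bs i.
  have [->|/span[ch chP]] := eqVneq (dg g) 0; first by exists (fun=> 0).
  by exists ch.
have [ch chP] := fin_all_exists gateE.
pose outs := enum [pred g : gate C | is_output g].
exists (fun (o : out_gate n n) (i : edge C + coord [:: a; b]) =>
  if [pick g | [&& is_output g, index g outs == val o.2 & dg g == bd (val o.1)]] is Some g then ch g i else 0) => h _.
split=> [zero g outg|zero o]; last first.
  case: pickP => [g /and3P[outg _ /eqP dR]|_]; last first.
    by rewrite big1 // => i _; rewrite mul0r.
  by rewrite -dR -ev_lincomb -chP ?zero // dR; apply: (valP o.1).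
have [->|gn0] := eqVneq (gate_poly g) 0; first exact: meval0.
have dgn0 : dg g != 0 by have := non_const g; rewrite outg gn0.
have := bidegree_le_total_degree gn0 (dgP g).
pose deg (g : gate C) := total_degree (gate_poly g).
have := leq_trans (leq_bigmax_cond (F := deg) _ outg) deg_le.
move=> le1 /leq_trans/(_ le1) dg_le.
have lt1 : ((dg g).1 < n.+1)%N by lia.
have lt2 : ((dg g).2 < n.+1)%N by lia.
have bdE : bd (r := n) (Ordinal lt1, Ordinal lt2) = dg g.
  by rewrite /bd /=; case: (dg g).
have Rn0 : bd (r := n) (Ordinal lt1, Ordinal lt2) != (0, 0)%N by rewrite bdE.
have lt_idx : (index g outs < n)%N.
  by apply: leq_trans outs_le; rewrite cardE index_mem mem_enum.
pose R : {R : bideg n | bd R != (0, 0)%N} :=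
  exist _ (Ordinal lt1, Ordinal lt2) Rn0.
have := zero (R, Ordinal lt_idx) => /=.
case: pickP => [g' /and3P[outg' /eqP eg' _]|/(_ g)]; last first.
  by rewrite outg bdE !eqxx.
(* Outputs with the same index in [outs] coincide, so the gate picked is [g]. *)
rewrite bdE -ev_lincomb (_ : g' = g) -?chP //.
by apply: (index_inj g (s := outs)) => //; rewrite mem_enum.
Qed.

(** * The reduction *)

Section Tuples.
Variable T : nat -> Type.

(** Matching on the number inside the ordinal makes each component reduce to the intended dependent
    type. *)
Definition pair_fun k0 k1 (p0 : T k0) (p1 : T k1) :
    forall i : 'I_2, T (nth 0%N [:: k0; k1] i) :=
  fun i => let: Ordinal j lt := i in
  match j return (j < 2)%N -> T (nth 0%N [:: k0; k1] j) with
  | 0 => fun=> p0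
  | 1 => fun=> p1
  | _.+2 => fun lt => False_rect _ (notF lt)
  end lt.

Definition triple_fun k0 k1 k2 (p0 : T k0) (p1 : T k1) (p2 : T k2) :
    forall i : 'I_3, T (nth 0%N [:: k0; k1; k2] i) :=
  fun i => let: Ordinal j lt := i in
  match j return (j < 3)%N -> T (nth 0%N [:: k0; k1; k2] j) with
  | 0 => fun=> p0
  | 1 => fun=> p1
  | 2 => fun=> p2
  | _.+3 => fun lt => False_rect _ (notF lt)
  end lt.

End Tuples.

Section ProjectivePoints.
Variable F : fieldType.

Lemma dim_line k (v : 'rV[F]_k) : v != 0 -> \dim <[v]> == 1%N.
Proof. by rewrite dim_vline => ->. Qed.

Definition line_of k (v : 'rV[F]_k) (nz : v != 0) : proj F k :=
  exist _ <[v]>%VS (dim_line nz).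

Section Padding.
Variables (a n : nat).
Hypothesis le_an : (a <= n)%N.

Definition padding : 'Hom('rV[F]_a, 'rV[F]_n) :=
  linfun (mulmxr (pid_mx a : 'M_(a, n))).

Lemma paddingE (v : 'rV[F]_a) i : padding v 0 (widen_ord le_an i) = v 0 i.
Proof.
rewrite lfunE /= mxE (bigD1 i) //= mxE eqxx ltn_ord mulr1 big1 ?addr0 // => j.
by rewrite mxE -val_eqE => /negbTE /= ->; rewrite mulr0.
Qed.

Lemma lker_padding : lker padding = 0%VS.
Proof.
apply/eqP/lker0P => u v e; apply/rowP => i.
by rewrite -!paddingE e.
Qed.

Lemma dim_padding (U : {vspace 'rV[F]_a}) :
  \dim U == 1%N -> \dim (padding @: U) == 1%N.
Proof. by rewrite limg_dim_eq // lker_padding capv0. Qed.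

Definition pad_proj (p : proj F a) : proj F n :=
  exist _ (padding @: sval p)%VS (dim_padding (svalP p)).

End Padding.
End ProjectivePoints.

Lemma circuit_reduction (F : fieldType) (c n a b : nat)
    (C : circuit F (coord [:: a; b])) :
  (0 < c)%N -> (0 < a)%N -> (0 < b)%N -> (a <= n)%N -> (circuit_size C <= n)%N ->
  (#|[pred g : gate C | is_output g]| <= n)%N ->
  (\max_(g : gate C | is_output g) total_degree (gate_poly g) <= n)%N ->
  is_arith_circuit C -> homogeneous_circuit C ->
  exists rho : mproj F [:: a] -> mproj F (ucr_space c n b),
    projective_linear rho /\
    forall x, ucr (rho x) <->
      exists z : mproj F [:: a; b], circuit_zeros C z /\ z ord0 = x ord0.
Proof.
move=> c_gt0 a_gt0 b_gt0 le_an size_le outs_le deg_le [acC _] homC.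
have [d [ic [bs [dg [d_neq0 bsX bsM dgP span]]]]] := bilinear_normal_form acC homC.
have [oc ocP] := output_coefficients bsX dgP span le_an outs_le deg_le.
have n_gt0 : (0 < n)%N := leq_trans a_gt0 le_an.
have s_gt0 : (0 < ucr_s n b)%N by rewrite /ucr_s; lia.
have leK : (#|edge C| <= c * ucr_s n b)%N.
  by rewrite /circuit_size /ucr_s in size_le *; nia.
pose s := ucr_s n b.
pose t := @control_vector F c n a b n s _ d ic oc.
have t_neq0 : t != 0 by apply: control_vector_neq0.
(* Values of the outputs at any representative of a point with control component [t]. The two
   inclusions below use it with [lambda] equal to 1 and arbitrary, respectively. *)
have outE (h : coord [:: a; b] -> F) (h' : coord [:: n; b; nb_control c n b n s] -> F)
    lambda o :
    (forall i, h (@mk_coord [:: a; b] 0 isT i) =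
       h' (@mk_coord [:: n; b; nb_control c n b n s] 0 isT (widen_ord le_an i))) ->
    (forall j, h (@mk_coord [:: a; b] 1 isT j) =
       h' (@mk_coord [:: n; b; nb_control c n b n s] 1 isT j)) ->
    (forall e, h' (@mk_coord [:: n; b; nb_control c n b n s] 2 isT e) =
       lambda * t 0 e) ->
    exists k, ev h' (gate_poly (C := Phi' F c n b n s) (inl (inl (OutG o)))) =
      lambda ^+ k * \sum_(i | level d i == bd (val o.1)) oc o i * ev h (bs i).
  move=> h_x h_y h_t.
  exists (4 * ((bd (val o.1)).1 + (bd (val o.1)).2) - 3)%N.
  apply: (phi_ev_sum c_gt0 n_gt0 b_gt0 n_gt0 s_gt0 (le_an := le_an)
    (v := fun i => ev h (bs i)) leK d_neq0 h_t _ _ _ (g := OutG o) erefl).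
  - by move=> i; rewrite bsX evX.
  - by move=> j; rewrite bsX evX.
  - by move=> k; rewrite bsM -!ev_lincomb /ev mevalM.
pose rho (x : mproj F [:: a]) : mproj F (ucr_space c n b) :=
  pair_fun (T := proj F) (pad_proj le_an (x ord0)) (line_of t_neq0).
exists rho; split.
  case=> [[|[|j]] lt] //; [right|left].
    exists ord0, (padding F a n); split=> //; exact: lker_padding.
  by exists (line_of t_neq0).
move=> x; split=> [[z [zeros z0 z2]]|[z [zeros z0]]].
  exists (pair_fun (T := proj F) (x ord0) (z (Ordinal (isT : 1 < 3)%N))).
  split=> // g outg u repu.
  pose h (v : coord [:: a; b]) := u (tag v) 0 (tagged v).
  pose u0 : 'rV[F]_a := u (Ordinal (isT : 0 < 2)%N).
  have [u0n0 u0x] : u0 != 0 /\ u0 \in sval (x ord0) := repu (Ordinal (isT : 0 < 2)%N).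
  pose u1 : 'rV[F]_b := u (Ordinal (isT : 1 < 2)%N).
  have repu1 : u1 != 0 /\ u1 \in _ := repu (Ordinal (isT : 1 < 2)%N).
  apply: (proj1 (ocP h _)) outg.
    by have /rV0Pn[i] := u0n0; exists i.
  move=> o.
  (* A representative of the point for [C] lifts to one for the universal circuit, with [t] itself
     as control vector. *)
  pose u' := triple_fun (T := fun k => 'rV[F]_k) (padding F a n u0) u1 t.
  pose h' (v : coord [:: n; b; nb_control c n b n s]) := u' (tag v) 0 (tagged v).
  have [|||k] := outE h h' 1 o.
  - by move=> i; rewrite /h' /= paddingE.
  - by [].
  - by move=> e; rewrite mul1r.
  rewrite expr1n mul1r => <-; apply: zeros.
    by rewrite control_output Phi_output.
  case=> [[|[|[|j]]] lt] //=.
  - rewrite (bool_irrelevance lt isT) z0; split.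
      apply: contraNneq u0n0 => p0; apply/eqP/rowP => i.
      by rewrite mxE -(paddingE le_an) p0 mxE.
    exact: memv_img.
  - by rewrite (bool_irrelevance lt isT).
  - by rewrite (bool_irrelevance lt isT) z2; split=> //; apply: memv_line.
exists (triple_fun (T := proj F) (pad_proj le_an (x ord0))
  (z (Ordinal (isT : 1 < 2)%N)) (line_of t_neq0)).
split=> // -g; rewrite control_output.
case: g => [[g|e]|e] //; rewrite Phi_output //; case: g => // o _ u repu.
(* Conversely, an arbitrary representative has a padded vector as first component and a multiple of
   [t] as last one. *)
have [_ /memv_imgP[u0 u0x u0E]] := repu (Ordinal (isT : 0 < 3)%N).
have [u0n0 _] := repu (Ordinal (isT : 0 < 3)%N).
have [u1n0 u1z] := repu (Ordinal (isT : 1 < 3)%N).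
have [_ /vlineP[lambda u2E]] := repu (Ordinal (isT : 2 < 3)%N).
pose u1 : 'rV[F]_b := u (Ordinal (isT : 1 < 3)%N).
pose v := pair_fun (T := fun k => 'rV[F]_k) u0 u1.
pose h (w : coord [:: a; b]) := v (tag w) 0 (tagged w).
pose h' (w : coord [:: n; b; nb_control c n b n s]) := u (tag w) 0 (tagged w).
have vn0 : u0 != 0.
  by apply: contraNneq u0n0 => e; rewrite u0E e linear0.
have [|||k outk] := outE h h' lambda o.
- move=> i; rewrite /h' /= [u _]u0E paddingE //.
- by [].
- by move=> e; rewrite /h' /= [u _]u2E mxE.
rewrite [LHS]outk (proj2 (ocP h _)) ?mulr0 //.
  by have /rV0Pn[i] := vn0; exists i.
move=> g outg; apply: zeros outg _ _.
case=> [[|[|j]] lt] //=.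
  rewrite (bool_irrelevance lt (ltn0Sn 1)); split=> //.
  exact: (eq_ind_r (fun p : proj F a => u0 \in sval p) u0x z0).
by rewrite (bool_irrelevance lt isT).
Qed.

(** * Polynomial bounds and hardness *)

Lemma poly_boundedD f g :
  poly_bounded f -> poly_bounded g -> poly_bounded (fun k => f k + g k)%N.
Proof.
by move=> [p fp] [q gq]; exists (p + q) => k; rewrite hornerD leq_add.
Qed.

Lemma poly_boundedM f g :
  poly_bounded f -> poly_bounded g -> poly_bounded (fun k => f k * g k)%N.
Proof.
by move=> [p fp] [q gq]; exists (p * q) => k; rewrite hornerM leq_mul.
Qed.

Lemma poly_boundedC m : poly_bounded (fun=> m).
Proof. by exists m%:P => k; rewrite hornerC. Qed.

Lemma poly_bounded_le f g : (forall k, f k <= g k)%N ->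
  poly_bounded g -> poly_bounded f.
Proof. by move=> fg [p gp]; exists p => k; apply: leq_trans (fg k) (gp k). Qed.

Theorem theorem1p18 :
  exists c0 : nat, (1 <= c0)%N /\
  forall c : nat, (c0 <= c)%N ->
  forall (F : fieldType) (en : nat -> nat * nat),
    quadratic_enumeration en ->
    @NPproj_hard F
      (fun k => ucr_space c (en k).1 (en k).2)
      (fun k => @ucr F c (en k).1 (en k).2).
Proof.
(* Already [c = 1] suffices: each level and type has [c * s >= n] product gates, and [n] will be at
   least the number of edges, hence of binary products. *)
exists 1%N; split=> // c c_gt0 F en [_ _ [K enK]] n1 X.
move=> [n2 [Y [[n1_bd n2_bd [C [CP size_bd outs_bd deg_bd]]] XY]]].
pose outs k := #|[pred g : gate (C k) | is_output g]|.
pose deg k := (\max_(g : gate (C k) | is_output g) total_degree (gate_poly g))%N.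
(* n is taken above every size parameter, so that r = n and s >= n suffice. *)
pose n k := ((n1 k).+1 + circuit_size (C k) + outs k + deg k)%N.
(* The position in the enumeration is at most quadratic in [n k + (n2 k).+1], so the index map of
   the reduction is polynomially bounded. *)
have pos_ex k : exists p, [&& (0 < p)%N, en p == (n k, (n2 k).+1) &
    (p <= K * (n k + (n2 k).+1) ^ 2)%N].
  have [//|//|p [p_gt0 en_p p_le]] := enK (n k) (n2 k).+1.
  by exists p; rewrite p_gt0 en_p eqxx.
exists (fun k => xchoose (pos_ex k)); split.
  apply: (@poly_bounded_le _ (fun k => K * ((n k + (n2 k).+1) * (n k + (n2 k).+1)))%N).
    by move=> k; have /and3P[_ _] := xchooseP (pos_ex k); rewrite mulnn.
  have S_bd f : poly_bounded f -> poly_bounded (fun k => (f k).+1).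
    by move=> f_bd; apply: poly_bounded_le (poly_boundedD f_bd (poly_boundedC 1)) => k;
       rewrite addn1.
  have sum_bd : poly_bounded (fun k => n k + (n2 k).+1)%N.
    apply: poly_boundedD; last exact: S_bd.
    by do !apply: poly_boundedD => //; apply: S_bd.
  by apply: poly_boundedM; [apply: poly_boundedC|apply: poly_boundedM].
move=> k k_gt0; have /and3P[p_gt0 /eqP en_p _] := xchooseP (pos_ex k).
split=> //; have [arC homC YC] := CP k k_gt0.
rewrite en_p /=.
have [||||rho [lin_rho rhoP]] :=
  @circuit_reduction F c (n k) (n1 k).+1 (n2 k).+1 (C k) c_gt0 isT isT _ _ _ _ arC homC.
- by rewrite /n; lia.
- by rewrite /n; lia.
- by rewrite /n /outs; lia.
- by rewrite /n /deg; lia.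
exists rho; split=> // x; rewrite rhoP XY //.
by split=> -[z [/YC Yz z0]]; exists z.
Qed.
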